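(* Consider a cube $P \subset \mathbb{R}^n$ and a point $x \in P$. Suppose that $P$ is a cell in a finite CAT(0) cubical complex $\mathbf{X}$ with distance $d$, and consider any point $a \in \mathbf{X}$. Let $d_a^P \colon P \to \mathbb{R}$, $d_a^P(w) = d(a,w)$, denote the restriction to $P$ of the distance function to $a$. (1) If $a = x$, then $0 \in \partial d_a^P(x)$. (2) Suppose $a \neq x$. In the geodesic $[x,a]$, let $[x,y]$ be an initial segment corresponding to an initial cell $Q$. Denote by $F = P \cap Q$ the common face of $P$ and $Q$. In any ambient Euclidean space for $Q$, denote the nearest point to $y$ in $F$ by $z$. If $z = x$, then $0 \in \partial d_a^P(x)$. If $z \neq x$, then $$\frac{\cos(\angle yxz)}{|x-z|}\,(x-z) \;\in\; \partial d_a^P(x).$$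
   Context: A polyhedral cell is a geodesic metric space isometric to the convex hull of finitely many points in a Euclidean space (it is identified with that convex hull); a face of a cell $C$ is a nonempty set that is either $C$ itself or the intersection of $C$ with a hyperplane $H$ such that $C$ lies in one of the closed half-spaces determined by $H$. A polyhedral complex is a set of polyhedral cells of various dimensions such that every face of a cell is a cell of the complex, and the intersection of any two cells is either empty or a face of both. The complex is finite if it has finitely many cells, and cubical if each $n$-dimensional cell is isometric to $[0,1]^n$. The distance $d(x,y)$ between two points of the complex is the infimum of the lengths $\sum_{i=1}^k |x_{i-1}-x_i|$ over finite sequences $x=x_0,x_1,\dots,x_k=y$ such that for each $i$ some cell contains both $x_{i-1}$ and $x_i$ (with $|x_{i-1}-x_i|$ the Euclidean distance in that cell). A geodesic metric space is CAT(0) if in every geodesic triangle, distances between points on its sides are no larger than the corresponding distances in a comparison triangle in $\mathbb{R}^2$ (a triangle with the same side lengths). CAT(0) spaces are uniquely geodesic; $[x,a]$ denotes the geodesic segment joining $x$ and $a$. Initial segments: for $a \neq x$ the geodesic $[x,a]$ passes via a sequence of nontrivial geodesics $[x,y_0],[y_0,y_1],\dots,[y_m,a]$ through some corresponding connected sequence of cells $Q_0,Q_1,\dots,Q_{m+1}$ (each segment lying in the corresponding cell; neither sequence is necessarily unique). The segment $[x,y_0]$ is called an initial segment and $Q_0$ a corresponding initial cell; thus $y_0 \in [x,a]$, $y_0 \ne x$ and $[x,y_0] \subset Q_0$. The angle $\angle yxz$ (for $y,z\neq x$) is the Alexandrov angle at $x$ between the geodesics $[x,y]$ and $[x,z]$,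 i.e. the limit, as points $y' \in [x,y]$ and $z'\in [x,z]$ distinct from $x$ tend to $x$, of the angle at $\bar x$ in a Euclidean comparison triangle for the triangle with vertices $y',x,z'$. Given a cube $P\subset\mathbb{R}^n$ and a convex function $e\colon P\to\mathbb{R}$, the subdifferential $\partial e(x)$ at $x \in P$ is the set of vectors $v\in\mathbb{R}^n$ (subgradients) such that $\langle v, w-x\rangle \le e(w)-e(x)$ for all $w\in P$. *)

(* Defs.v *)
From mathcomp Require Import all_boot all_order all_algebra.
From mathcomp Require Import all_classical all_reals all_analysis.

Set Implicit Arguments.
Unset Strict Implicit.
Unset Printing Implicit Defensive.

Import Order.TTheory GRing.Theory Num.Theory.
Import numFieldNormedType.Exports.

Local Open Scope classical_set_scope.
Local Open Scope ring_scope.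

(* Euclidean space R^n is 'rV[R]_n.  The library norm `|u| on row vectors is
   the max norm, hence the explicit inner product and norm below. *)

Section Euclidean.
Variables (R : realType) (n : nat).
Implicit Types u v w : 'rV[R]_n.

Definition dotv u v : R := \sum_(i < n) u 0 i * v 0 i.

Definition enorm u : R := Num.sqrt (dotv u u).

Definition eangle u v w : R :=
  acos (dotv (u - v) (w - v) / (enorm (u - v) * enorm (w - v))).

Definition conv_hull (k : nat) (p : 'I_k -> 'rV[R]_n) : set 'rV[R]_n :=
  [set w | exists a : 'I_k -> R,
     [/\ forall i, 0 <= a i, \sum_(i < k) a i = 1
       & w = \sum_(i < k) a i *: p i]].

Definition unit_cube : set 'rV[R]_n :=
  [set u | forall i, 0 <= u 0 i <= 1].

End Euclidean.

Section MetricGeometry.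
Variables (R : realType) (T : Type) (d : T -> T -> R).

Definition is_metric : Prop :=
  [/\ forall x y, 0 <= d x y,
      forall x y, d x y = 0 <-> x = y,
      forall x y, d x y = d y x
    & forall x y z, d x z <= d x y + d y z].

(* Unit-speed geodesic from x to y; only the values of g on [0, d x y]
   matter. *)
Definition geodesic (x y : T) (g : R -> T) : Prop :=
  [/\ g 0 = x, g (d x y) = y
    & forall s t, 0 <= s <= d x y -> 0 <= t <= d x y ->
        d (g s) (g t) = `|s - t|].

(* The points lying on a geodesic from x to y: the geodesic segment [x, y]
   when the space is uniquely geodesic. *)
Definition segment (x y : T) : set T :=
  [set z | exists2 g, geodesic x y g &
             exists2 t, 0 <= t <= d x y & z = g t].

Definition geodesic_space : Prop :=
  is_metric /\ forall x y, exists g, geodesic x y g.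

Definition comparison_triangle (x y z : T) (x' y' z' : 'rV[R]_2) : Prop :=
  [/\ enorm (x' - y') = d x y, enorm (y' - z') = d y z
    & enorm (x' - z') = d x z].

(* The CAT(0) inequality is stated for a point on the side [x, y] and one on
   the side [x, z]; since x, y, z are arbitrary, this covers any two sides.
   (Two points on the same side are equally far apart in the comparison
   triangle.) *)
Definition cat0 : Prop :=
  geodesic_space /\
  forall (x y z : T) (gxy gyz gxz : R -> T) (x' y' z' : 'rV[R]_2) (s t : R),
    geodesic x y gxy -> geodesic y z gyz -> geodesic x z gxz ->
    comparison_triangle x y z x' y' z' ->
    0 <= s <= 1 -> 0 <= t <= 1 ->
    d (gxy (s * d x y)) (gxz (t * d x z)) <=
      enorm ((x' + s *: (y' - x')) - (x' + t *: (z' - x'))).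

(* Angle at x of a comparison triangle for y, x, z. *)
Definition comparison_angle (y x z : T) : R :=
  xget 0 [set th | exists y' x' z', comparison_triangle y x z y' x' z' /\
                     th = eangle y' x' z'].

(* (y', z') tends to (x, x) with y' in [x, y], z' in [x, z], both distinct
   from x. *)
Definition angle_filter (y x z : T) : set_system (T * T) :=
  filter_from [set e : R | 0 < e] (fun e => [set p |
    [/\ segment x y p.1, p.1 <> x & d x p.1 < e] /\
    [/\ segment x z p.2, p.2 <> x & d x p.2 < e]]).

Definition alexandrov_angle (y x z : T) : R :=
  lim ((fun p => comparison_angle p.1 x p.2) @ angle_filter y x z).

End MetricGeometry.

(* A cell is a set C of points of a common space T, with a metric dC of which
   only the values on C matter.  A chart of C identifies it isometrically with
   a subset of R^n; n need not be the dimension of C. *)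

Section Cells.
Variables (R : realType) (T : Type).
Implicit Types (C F : set T) (dC : T -> T -> R).

Definition chart C dC (n : nat) (phi : T -> 'rV[R]_n) : Prop :=
  set_inj C phi /\
  forall x y, C x -> C y -> enorm (phi x - phi y) = dC x y.

Definition polyhedral_cell C dC : Prop :=
  exists (n k : nat) (phi : T -> 'rV[R]_n) (p : 'I_k.+1 -> 'rV[R]_n),
    chart C dC phi /\ phi @` C = conv_hull p.

Definition cube_cell C dC : Prop :=
  exists (n : nat) (phi : T -> 'rV[R]_n),
    chart C dC phi /\ phi @` C = @unit_cube R n.

(* The hyperplane is { u | dotv v u = c }. *)
Definition face C dC F : Prop :=
  F !=set0 /\
  (F = C \/
   exists (n : nat) (phi : T -> 'rV[R]_n) (v : 'rV[R]_n) (c : R),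
     [/\ chart C dC phi, v != 0,
         forall x, C x -> dotv v (phi x) <= c
       & F = C `&` [set x | dotv v (phi x) = c]]).

End Cells.

Record polyhedral_complex (R : realType) := PolyhedralComplex {
  carrier : Type;
  cells : set (set carrier);
  cdist : set carrier -> carrier -> carrier -> R;
  cells_cover : forall x, exists2 C, cells C & C x;
  cells_polyhedral : forall C, cells C -> polyhedral_cell C (cdist C);
  cells_face : forall C F, cells C -> face C (cdist C) F ->
    cells F /\ forall x y, F x -> F y -> cdist F x y = cdist C x y;
  cells_meet : forall C D, cells C -> cells D ->
    C `&` D = set0 \/
    face C (cdist C) (C `&` D) /\ face D (cdist D) (C `&` D)
}.

Section Complexes.
Variables (R : realType) (X : polyhedral_complex R).

Definition finite_complex : Prop := finite_set (@cells R X).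

Definition cubical : Prop :=
  forall C : set (carrier X), cells C -> cube_cell C (cdist C).

(* The infimum of the lengths of strings p 0, ..., p k from x to y, the i-th
   piece being measured in a cell C i containing its two ends.  The real [inf]
   of the empty set is 0, so points not joined by any string are at distance
   0; then [complex_dist] is not a metric, so this cannot occur under
   [cat0]. *)
Definition complex_dist (x y : carrier X) : R :=
  inf [set l | exists (k : nat) (p : nat -> carrier X)
                      (C : nat -> set (carrier X)),
    [/\ p 0%N = x, p k = y,
        forall i, (i < k)%N -> [/\ cells (C i), C i (p i) & C i (p i.+1)]
      & l = \sum_(i < k) cdist (C i) (p i) (p i.+1)]].

(* [x, y] is an initial segment of [x, a], with initial cell Q: the geodesic
   [x, a] is broken at successive points x = p 0, p 1 = y, ..., p k.+1 = a
   into nontrivial segments, each lying in a cell, the first one in Q 0 = Q.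
   A single segment (k = 0, y = a) is allowed. *)
Definition initial_segment (x a y : carrier X) (Q : set (carrier X)) : Prop :=
  exists (k : nat) (p : nat -> carrier X) (C : nat -> set (carrier X)),
    [/\ p 0%N = x, p k.+1 = a, p 1%N = y, C 0%N = Q
      & forall i, (i <= k)%N ->
          [/\ segment complex_dist x a (p i.+1),
              complex_dist x (p i) < complex_dist x (p i.+1),
              cells (C i)
            & segment complex_dist (p i) (p i.+1) `<=` C i]].

End Complexes.

(* P is identified with phi @` P in R^n, and e is a function on P. *)
Definition subdifferential (R : realType) (T : Type) (n : nat)
    (phi : T -> 'rV[R]_n) (P : set T) (e : T -> R) (x : T) : set 'rV[R]_n :=
  [set v | forall w, P w -> dotv v (phi w - phi x) <= e w - e x].

Definition nearest_point (R : realType) (T : Type) (n : nat)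
    (psi : T -> 'rV[R]_n) (F : set T) (y z : T) : Prop :=
  F z /\ forall w, F w -> enorm (psi y - psi z) <= enorm (psi y - psi w).

(* Main.v *)
(* All cells of the star of x project orthogonally onto their intersections
   with Q.  In a cube, faces through x are coordinate faces, so these projections
   commute with passing to faces and fit together into a retraction of a
   neighborhood of x onto Q which is 1-Lipschitz for the complex metric.  Applied
   to Q itself, this makes segments of cells local geodesics, hence geodesics by
   CAT(0), and so each cell is isometrically embedded.

   For w in P let w_s be the point of [x, w] at distance s d(x, w) from x, and
   y_t the point of [x, a] at distance t from x.  The retraction gives
     d(w_s, y_t)^2 >= t^2 - 2 t s c,   c = <w - x, z - x> / |y - x|,
   whereas the CAT(0) inequality in the triangle x, w, a gives, writing
   W = d(x, w), A = d(x, a), D = d(w, a),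
     d(w_s, y_t)^2 <= s^2 W^2 + t^2 - s t (W^2 + A^2 - D^2) / A.
   As s tends to 0, D^2 >= W^2 + A^2 - 2 A c >= (A - c)^2, since |c| <= W.  Finally
   cos(angle y x z) = |x - z| / |y - x|, so that - c is the pairing of w - x with
   the claimed subgradient. *)

Require Import Defs.
From mathcomp Require Import all_boot all_order all_algebra.
From mathcomp Require Import all_classical all_reals all_analysis.
From mathcomp Require Import ring lra.
Import Order.TTheory GRing.Theory Num.Theory.
Import numFieldNormedType.Exports.
Local Open Scope classical_set_scope.
Local Open Scope ring_scope.

(** * Inner product and Euclidean norm on row vectors *)

Section EuclideanSpace.
Context {R : realType} {n : nat}.
Implicit Types u v w : 'rV[R]_n.

Lemma dotvC u v : dotv u v = dotv v u.
Proof. by apply: eq_bigr => i _; rewrite mulrC. Qed.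

Lemma dotvDl u v w : dotv (u + v) w = dotv u w + dotv v w.
Proof. by rewrite -big_split; apply: eq_bigr => i _; rewrite mxE mulrDl. Qed.

Lemma dotvZl k u v : dotv (k *: u) v = k * dotv u v.
Proof. by rewrite mulr_sumr; apply: eq_bigr => i _; rewrite mxE mulrA. Qed.

Lemma dotvNl u v : dotv (- u) v = - dotv u v.
Proof. by rewrite -scaleN1r dotvZl mulN1r. Qed.

Lemma dotvBl u v w : dotv (u - v) w = dotv u w - dotv v w.
Proof. by rewrite dotvDl dotvNl. Qed.

Lemma dotvZr k u v : dotv u (k *: v) = k * dotv u v.
Proof. by rewrite dotvC dotvZl dotvC. Qed.

Lemma dotvBr u v w : dotv u (v - w) = dotv u v - dotv u w.
Proof. by rewrite dotvC dotvBl !(dotvC u). Qed.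

Lemma dotv0l v : dotv 0 v = 0.
Proof. by rewrite -(subrr v) dotvBl subrr. Qed.

Lemma dotv_suml (I : finType) (f : I -> 'rV[R]_n) v :
  dotv (\sum_i f i) v = \sum_i dotv (f i) v.
Proof.
by elim/big_rec2: _ => [|i x y _ <-]; rewrite ?dotv0l ?dotvDl.
Qed.

Lemma dotv_ge0 u : 0 <= dotv u u.
Proof. by apply: sumr_ge0 => i _; rewrite -expr2 sqr_ge0. Qed.

Lemma dotv_eq0 u : dotv u u = 0 -> u = 0.
Proof.
move=> /eqP; rewrite psumr_eq0 => [/allP u0|i _]; last by rewrite -expr2 sqr_ge0.
apply/rowP => i; rewrite mxE; apply/eqP.
by move: (u0 i); rewrite mem_index_enum -expr2 sqrf_eq0 => /(_ isT).
Qed.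

Lemma enorm_ge0 u : 0 <= enorm u. Proof. exact: sqrtr_ge0. Qed.

Lemma sqr_enorm u : enorm u ^+ 2 = dotv u u.
Proof. by rewrite sqr_sqrtr ?dotv_ge0. Qed.

Lemma enorm_eq0 u : enorm u = 0 -> u = 0.
Proof. by move=> u0; apply: dotv_eq0; rewrite -sqr_enorm u0 expr0n. Qed.

Lemma enorm0 : enorm (0 : 'rV[R]_n) = 0.
Proof. by rewrite /enorm dotv0l sqrtr0. Qed.

Lemma enorm_sub u v :
  enorm (u - v) ^+ 2 = enorm u ^+ 2 + enorm v ^+ 2 - dotv u v *+ 2.
Proof. by rewrite !sqr_enorm dotvBl !dotvBr (dotvC v u); ring. Qed.

Lemma enormN u : enorm (- u) = enorm u.
Proof. by rewrite /enorm dotvNl dotvC dotvNl opprK. Qed.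

Lemma enormB u v : enorm (u - v) = enorm (v - u).
Proof. by rewrite -enormN opprB. Qed.

Lemma enormZ k u : enorm (k *: u) = `|k| * enorm u.
Proof.
by rewrite /enorm dotvZl dotvZr mulrA -expr2 sqrtrM ?sqr_ge0// sqrtr_sqr.
Qed.

Lemma cauchy_schwarz u v : `|dotv u v| <= enorm u * enorm v.
Proof.
have [v0|v0] := eqVneq (enorm v) 0.
  by rewrite (enorm_eq0 _ v0) dotvC dotv0l normr0 enorm0 mulr0.
have vp : 0 < enorm v by rewrite lt_def v0 enorm_ge0.
rewrite -ler_sqr ?nnegrE ?mulr_ge0 ?enorm_ge0// real_normK ?num_real//.
have := dotv_ge0 (enorm v ^+ 2 *: u - dotv u v *: v).
rewrite !(dotvBl, dotvBr, dotvZl, dotvZr) (dotvC v u) -!sqr_enorm exprMn.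
have vp2 : 0 < enorm v ^+ 2 by rewrite exprn_gt0.
move=> h; rewrite -(ler_pM2r vp2); nra.
Qed.

Lemma enormD_le u v : enorm (u + v) <= enorm u + enorm v.
Proof.
rewrite -ler_sqr ?nnegrE ?addr_ge0 ?enorm_ge0//.
rewrite -[v in u + v]opprK enorm_sub enormN.
have := cauchy_schwarz u (- v); rewrite enormN ler_norml => /andP[+ _].
by move=> ?; nra.
Qed.

(** Equality case of the triangle inequality: [dotv u v = t * r] is forced. It makes geodesics
    inside a cell straight in charts. *)
Lemma enorm_between u v t r : 0 < r -> enorm u = t -> enorm v = r ->
  enorm (u - v) = r - t -> u = (t / r) *: v.
Proof.
move=> r0 ut vr uv; apply/eqP; rewrite -subr_eq0; apply/eqP/enorm_eq0.
have duv : dotv u v = t * r by move: (enorm_sub u v); rewrite ut vr uv; nra.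
apply/eqP; rewrite -sqrf_eq0 enorm_sub enormZ exprMn real_normK ?num_real//.
rewrite dotvZr ut vr duv; apply/eqP; field; exact: lt0r_neq0.
Qed.

End EuclideanSpace.

(** * Cubes in charts: faces and orthogonal projections onto them *)

Section Cells.
Context {R : realType} {T : Type} (C : set T) (dC : T -> T -> R).

(** By polarization, the inner product of [p - x] and [q - x] in any chart; written with distances
    only, it depends on no chart. *)
Definition cell_dot (x p q : T) : R :=
  (dC x p ^+ 2 + dC x q ^+ 2 - dC p q ^+ 2) / 2.

Lemma chart_dot {n} {phi : T -> 'rV[R]_n} : chart C dC phi ->
  forall x p q, C x -> C p -> C q ->
  dotv (phi p - phi x) (phi q - phi x) = cell_dot x p q.
Proof.
move=> [_ iso] x p q Cx Cp Cq; rewrite /cell_dot -!iso//.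
rewrite -(enormB (phi p)) -(enormB (phi q)).
have := enorm_sub (phi p - phi x) (phi q - phi x).
have -> : phi p - phi x - (phi q - phi x) = phi p - phi q.
  by rewrite opprB addrA subrK.
by move=> ->; field.
Qed.

(* A change of charts preserves inner products, hence linear relations. *)
Lemma chart_affine {n m k} {phi : T -> 'rV[R]_n} {psi : T -> 'rV[R]_m} :
  chart C dC phi -> chart C dC psi ->
  forall (o p : T) (q : 'I_k -> T) (c : 'I_k -> R),
  C o -> C p -> (forall i, C (q i)) ->
  phi p - phi o = \sum_i c i *: (phi (q i) - phi o) ->
  psi p - psi o = \sum_i c i *: (psi (q i) - psi o).
Proof.
move=> cphi cpsi o p q c Co Cp Cq e.
apply/eqP; rewrite -subr_eq0; apply/eqP/dotv_eq0.
set E := _ - _.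
have E0 r : C r -> dotv E (psi r - psi o) = 0.
  move=> Cr; have := congr1 (fun u => dotv u (phi r - phi o)) e.
  rewrite /= dotv_suml (chart_dot cphi)// => {}e.
  rewrite dotvBl dotv_suml (chart_dot cpsi)// e; apply/eqP.
  rewrite subr_eq0; apply/eqP/eq_bigr => i _.
  by rewrite !dotvZl (chart_dot cphi)// (chart_dot cpsi).
rewrite {2}/E dotvBr E0// dotvC dotv_suml big1 ?subr0// => i _.
by rewrite dotvZl dotvC E0// mulr0.
Qed.

Hypothesis cubeC : cube_cell C dC.

Lemma cell_dist_ge0 p q : C p -> C q -> 0 <= dC p q.
Proof.
by case: cubeC => n [phi [[_ iso] _]] Cp Cq; rewrite -iso// enorm_ge0.
Qed.

Lemma cell_distC p q : C p -> C q -> dC p q = dC q p.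
Proof.
by case: cubeC => n [phi [[_ iso] _]] Cp Cq; rewrite -!iso// enormB.
Qed.

Lemma cell_dist_triangle p q r : C p -> C q -> C r ->
  dC p r <= dC p q + dC q r.
Proof.
case: cubeC => n [phi [[_ iso] _]] Cp Cq Cr; rewrite -!iso//.
by apply: le_trans (enormD_le _ _); rewrite addrA subrK.
Qed.

Lemma cell_dist_eq0 p q : C p -> C q -> dC p q = 0 -> p = q.
Proof.
case: cubeC => n [phi [[inj iso] _]] Cp Cq; rewrite -iso// => /enorm_eq0.
by move/eqP; rewrite subr_eq0 => /eqP; apply: inj; rewrite inE.
Qed.

Lemma cell_distxx p : C p -> dC p p = 0.
Proof.
by case: cubeC => n [phi [[_ iso] _]] Cp; rewrite -iso// subrr enorm0.
Qed.

Lemma cell_dotC x p q : C p -> C q -> cell_dot x p q = cell_dot x q p.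
Proof. by move=> Cp Cq; rewrite /cell_dot (cell_distC p q)//; ring. Qed.

Lemma cell_dotxx x p : C p -> cell_dot x p p = dC x p ^+ 2.
Proof. by move=> Cp; rewrite /cell_dot cell_distxx//; field. Qed.

(** The image of [phi] need not be a cube: the point is found in a chart onto the unit cube and
    carried over by [chart_affine]. *)
Lemma cell_convex {n} {phi : T -> 'rV[R]_n} : chart C dC phi ->
  forall p q s, C p -> C q -> 0 <= s <= 1 ->
  exists2 r, C r & phi r = phi p + s *: (phi q - phi p).
Proof.
move=> cphi p q s Cp Cq /andP[s0 s1].
case: cubeC => m [psi [cpsi im]].
have cube r : C r -> unit_cube (psi r) by move=> Cr; rewrite -im; exists r.
have : unit_cube (psi p + s *: (psi q - psi p)).
  move=> i; rewrite !mxE; have := cube p Cp i; have := cube q Cq i.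
  by move=> /andP[? ?] /andP[? ?]; apply/andP; split; nra.
rewrite -im => -[r Cr e]; exists r => //.
have := chart_affine (k := 1) cpsi cphi p r (fun _ => q) (fun _ => s) Cp Cr.
rewrite !big_ord1 => h; apply/eqP; rewrite addrC -subr_eq; apply/eqP/h => //.
by rewrite e addrC addKr.
Qed.

(* A linear functional that is maximal at x on the cube has, coordinate by
   coordinate, a nonpositive increment; the face is cut out by the coordinates
   along which the functional is not constant. *)
Lemma face_coordinates {n} {phi : T -> 'rV[R]_n} :
  chart C dC phi -> phi @` C = @unit_cube R n ->
  forall G x, face C dC G -> G x -> exists I : pred 'I_n,
  forall p, C p -> (G p <-> forall i, I i -> phi p 0 i = phi x 0 i).
Proof.
move=> cphi im G x [_ [-> Cx|]]; first by exists pred0 => p Cp; split.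
move=> [m [psi [v [c [cpsi _ lec ->]]]]] [Cx /= lx].
have surj u : unit_cube u -> exists2 p, C p & phi p = u.
  by rewrite -im => -[p Cp <-]; exists p.
have cube p : C p -> unit_cube (phi p) by move=> Cp; rewrite -im; exists p.
have [b Cb b0] : exists2 p, C p & phi p = 0.
  by apply: surj => i; rewrite mxE lexx ler01.
have /choice[q hq] : forall i : 'I_n, exists p, C p /\ phi p = delta_mx 0 i.
  move=> i; have [|p Cp e] := surj (delta_mx 0 i); last by exists p.
  by move=> j; rewrite mxE eqxx /=; case: (j == i); rewrite /= ?lexx ?ler01.
have Cq i : C (q i) by case: (hq i).
(* The hyperplane lives in [psi]; [al] holds the coefficients of its functional in the cube
   coordinates of [phi]. *)
pose al i := dotv v (psi (q i) - psi b).
have lE p : C p -> dotv v (psi p) = dotv v (psi b) + \sum_i phi p 0 i * al i.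
  move=> Cp.
  have := chart_affine cphi cpsi b p q (fun i => phi p 0 i) Cb Cp Cq.
  have e : phi p - phi b = \sum_i phi p 0 i *: (phi (q i) - phi b).
    rewrite b0 subr0 {1}(row_sum_delta (phi p)); apply: eq_bigr => i _.
    by rewrite subr0; case: (hq i) => _ ->.
  move=> /(_ e) /(congr1 (dotv v)); rewrite dotvBr dotvC => /eqP.
  rewrite subr_eq => /eqP ->; rewrite dotvC addrC dotv_suml; congr (_ + _).
  by apply: eq_bigr => i _; rewrite dotvZl dotvC.
have le0 p i : C p -> al i * (phi p 0 i - phi x 0 i) <= 0.
  move=> Cp.
  have [|r Cr er] := surj (\row_j if j == i then phi p 0 i else phi x 0 j).
    by move=> j; rewrite mxE; case: eqP => _; exact: cube.
  have := lec r Cr; rewrite -lx (lE _ Cr) (lE _ Cx) lerD2l.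
  rewrite (bigD1 i)//= [leRHS](bigD1 i)//= er mxE eqxx.
  under eq_bigr => j ji do rewrite mxE (negbTE ji).
  by rewrite lerD2r -subr_ge0 -mulrBl mulrC -opprB mulrN oppr_ge0.
exists (fun i => al i != 0) => p Cp; split=> [[_ /= lp] i ali|h].
  have : \sum_i al i * (phi x 0 i - phi p 0 i) = 0.
    move: lp; rewrite -lx (lE _ Cp) (lE _ Cx) => /addrI e.
    rewrite -[RHS](subrr (\sum_i phi x 0 i * al i)) -{2}e -sumrB.
    by apply: eq_bigr => j _; ring.
  move=> /eqP; rewrite psumr_eq0 => [/allP /(_ i)|j _]; last first.
    by have := le0 p j Cp; lra.
  rewrite mem_index_enum mulf_eq0 (negbTE ali) subr_eq0 => /(_ isT) /eqP.
  by move=> ->.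
split=> //=; rewrite -lx (lE _ Cp) (lE _ Cx); congr (_ + _); apply: eq_bigr => i _.
by have [->|/h->//] := eqVneq (al i) 0; rewrite !mulr0.
Qed.

(** For [x] in [G], this is orthogonal projection: [p - q] is orthogonal to [r - x] for all [r] in
    [G]. Inner products based at [x] avoid a chart. *)
Definition cell_proj (G : set T) (x p q : T) : Prop :=
  G q /\ forall r, G r -> cell_dot x p r = cell_dot x q r.

(** In cube coordinates a face through [x] fixes some coordinates at their values at [x]; projecting
    overwrites these, which cannot leave another face through [x]. *)
Lemma face_projection G x p : face C dC G -> G x -> C x -> C p ->
  exists q, [/\ C q, cell_proj G x p q
    & forall H, face C dC H -> H x -> H p -> H q].
Proof.
case: cubeC => n [phi [cphi im]] fG Gx Cx Cp.
have [I hI] := face_coordinates cphi im G x fG Gx.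
have cube r : C r -> unit_cube (phi r) by move=> Cr; rewrite -im; exists r.
have : unit_cube (\row_i if I i then phi x 0 i else phi p 0 i).
  by move=> i; rewrite mxE; case: (I i); apply: cube.
rewrite -im => -[q Cq eq]; exists q.
have coord i : phi q 0 i = if I i then phi x 0 i else phi p 0 i.
  by rewrite eq mxE.
have GC r : G r -> C r.
  by case: fG => _ [->//|[m [psi [v [c [_ _ _ ->]]]]] []].
split=> // [|H fH Hx Hp].
  split=> [|r Gr]; first by apply/(hI q Cq) => i Ii; rewrite coord Ii.
  have Cr := GC _ Gr.
  rewrite -!(chart_dot cphi)//; apply: eq_bigr => i _; rewrite !mxE coord.
  have [/((hI r Cr).1 Gr i) ->|//] := boolP (I i).
  by rewrite subrr !mulr0.
have [J hJ] := face_coordinates cphi im H x fH Hx.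
apply/(hJ q Cq) => i Ji; rewrite coord; case: ifP => // _.
exact: (hJ p Cp).1.
Qed.

End Cells.

Section CellProjection.
Context {R : realType} {T : Type} (C : set T) (dC : T -> T -> R).
Hypothesis cubeC : cube_cell C dC.

(** By orthogonality [p - q] pairs with [p' - q'] to the squared norm of the latter; Cauchy-Schwarz
    concludes. *)
Lemma cell_proj_contract G x p p' q q' : G `<=` C -> C x -> C p -> C q ->
  cell_proj dC G x p p' -> cell_proj dC G x q q' -> dC p' q' <= dC p q.
Proof.
move=> GC Cx Cp Cq [Gp' hp] [Gq' hq].
have [Cp' Cq'] := (GC _ Gp', GC _ Gq').
case: cubeC => n [phi [cphi _]]; have [_ iso] := cphi.
have dot r s : C r -> C s ->
    dotv (phi r - phi x) (phi s - phi x) = cell_dot dC x r s.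
  by move=> Cr Cs; rewrite (chart_dot _ _ cphi).
have e : dotv (phi p - phi q) (phi p' - phi q') = enorm (phi p' - phi q') ^+ 2.
  rewrite sqr_enorm.
  have sub r s : phi r - phi s = (phi r - phi x) - (phi s - phi x).
    by rewrite opprB addrA subrK.
  have dotBB r s t u : dotv (r - s : 'rV_n) (t - u) =
      dotv r t - dotv r u - (dotv s t - dotv s u).
    by rewrite dotvBl !dotvBr.
  by rewrite (sub p q) (sub p' q') dotBB [RHS]dotBB !dot// !hp// !hq.
rewrite -!iso//; have := cauchy_schwarz (phi p - phi q) (phi p' - phi q').
have := enorm_ge0 (phi p' - phi q'); rewrite le_eqVlt => /predU1P[<- _|d0].
  exact: enorm_ge0.
by rewrite e ger0_norm ?sqr_ge0// expr2 ler_pM2r.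
Qed.

Lemma cell_proj_uniq G x p q q' : G `<=` C -> C x -> C p ->
  cell_proj dC G x p q -> cell_proj dC G x p q' -> q = q'.
Proof.
move=> GC Cx Cp hq hq'; have [Gq _] := hq; have [Gq' _] := hq'.
have [Cq Cq'] := (GC _ Gq, GC _ Gq').
apply: (cell_dist_eq0 _ _ cubeC) => //; apply/eqP; rewrite eq_le.
rewrite (cell_dist_ge0 _ _ cubeC)// andbT.
rewrite -(cell_distxx _ _ cubeC p)//.
exact: cell_proj_contract hq hq'.
Qed.

End CellProjection.

(** * The star of a point: coherent projections and the local retraction *)

Section CubicalComplex.
Context {R : realType} (X : polyhedral_complex R).
Hypotheses (Xfin : finite_complex X) (Xcub : cubical X).
Local Notation dist := (@complex_dist R X).
Implicit Types (C D Q : set (carrier X)) (x p q r : carrier X).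

Lemma meet_face C D x : cells C -> cells D -> C x -> D x ->
  face C (cdist C) (C `&` D) /\ face D (cdist D) (C `&` D).
Proof.
move=> cC cD Cx Dx; have [CD0|//] := cells_meet cC cD.
by have : (C `&` D) x by []; rewrite CD0.
Qed.

Lemma cdist_meet C D p q : cells C -> cells D -> C p -> D p -> C q -> D q ->
  cdist C p q = cdist D p q.
Proof.
move=> cC cD Cp Dp Cq Dq; have [fC fD] := meet_face _ _ p cC cD Cp Dp.
have [_ hC] := cells_face cC fC; have [_ hD] := cells_face cD fD.
by rewrite -hC// -hD.
Qed.

Lemma cell_dot_meet C D x p q : cells C -> cells D ->
  C x -> D x -> C p -> D p -> C q -> D q ->
  cell_dot (cdist C) x p q = cell_dot (cdist D) x p q.
Proof. by move=> *; rewrite /cell_dot !(cdist_meet C D). Qed.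

(** The last clause, stability of every cell through [x] and [p], is what lets projections from
    different cells be compared. *)
Lemma meet_projection C Q x p : cells C -> cells Q -> C x -> Q x -> C p ->
  exists q, [/\ C q, Q q, cell_proj (cdist C) (C `&` Q) x p q &
    forall D, cells D -> D x -> D p -> D q].
Proof.
move=> cC cQ Cx Qx Cp; have [fC _] := meet_face _ _ x cC cQ Cx Qx.
have [//|//|//|q [Cq [CQq hq] com]] := face_projection _ _ (Xcub _ cC) _ x p fC.
exists q; split=> // [|D cD Dx Dp]; first by case: CQq.
by have [fD _] := meet_face _ _ x cC cD Cx Dx; have [] := com _ fD.
Qed.

(** A test point [r] is replaced by its projection [s] onto the intersection of [D] and [C], which
    stays in [Q]; inner products of [p] and [q] with [r] are then those with [s], computed in
    [C]. *)
Lemma cell_proj_coherent C D Q x p q : cells C -> cells D -> cells Q ->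
  C x -> D x -> Q x -> C p -> D p ->
  cell_proj (cdist C) (C `&` Q) x p q -> cell_proj (cdist D) (D `&` Q) x p q.
Proof.
move=> cC cD cQ Cx Dx Qx Cp Dp hq.
have [q' [Cq' Qq' hq' com]] := meet_projection _ _ _ _ cC cQ Cx Qx Cp.
have eqq : q' = q by apply: (cell_proj_uniq _ _ (Xcub _ cC)) hq' hq => // r [].
move: Cq' Qq' com; rewrite eqq => Cq Qq com; have Dq := com _ cD Dx Dp.
split=> // r [Dr Qr].
have [s [Ds Cs [_ hs] coms]] := meet_projection _ _ _ _ cD cC Dx Cx Dr.
have Qs := coms _ cQ Qx Qr.
have e t : C t -> D t -> cell_dot (cdist D) x t r = cell_dot (cdist C) x t s.
  move=> Ct Dt; rewrite (cell_dotC _ _ (Xcub _ cD))// hs//.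
  by rewrite (cell_dotC _ _ (Xcub _ cD))// (cell_dot_meet D C).
by rewrite !e//; apply: hq.2.
Qed.

Lemma uniform_radius {T : eqType} (A : set T) (P : T -> R -> Prop) :
  finite_set A -> (forall i e e', e' <= e -> P i e -> P i e') ->
  (forall i, A i -> exists2 e, 0 < e & P i e) ->
  exists2 e, 0 < e & forall i, A i -> P i e.
Proof.
move=> /finite_seqP[s ->] down; elim: s => [|i s IH] h.
  by exists 1.
have [j js|e e0 he] := IH; first by apply: h; rewrite /= inE js orbT.
have [|e' e'0 he'] := h i; first by rewrite /= inE eqxx.
exists (Num.min e e'); first by rewrite lt_min e0.
move=> j /=; rewrite inE => /predU1P[->|/he].
  by apply: down he'; rewrite ge_min lexx orbT.
by apply: down; rewrite ge_min lexx.
Qed.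

(** Finiteness of the complex enters here. If [D] misses [x] and meets [C], the intersection is a
    face of [C] in a hyperplane missing [x]; the distance from [x] to it is a valid radius. *)
Lemma star_radius x : exists2 e, 0 < e & forall C D p, cells C -> cells D ->
  C x -> C p -> D p -> cdist C x p < e -> D x.
Proof.
pose P C D e := forall p, C x -> C p -> D p -> cdist C x p < e -> D x.
have dP C D e e' : e' <= e -> P C D e -> P C D e'.
  by move=> le h p Cx Cp Dp lt; apply: h Dp (lt_le_trans lt le).
have [C e e' le h D cD|C cC|e e0 he] := @uniform_radius _ _
  (fun C e => forall D, cells D -> P C D e) Xfin; last first.
- by exists e => // C D p cC cD; exact: he.
- apply: uniform_radius => // [D|D cD]; first exact: dP.
  have [Cx|nCx] := pselect (C x); last by exists 1.
  have [Dx|nDx] := pselect (D x); first by exists 1.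
  have [CD0|[[_ [CD|hCD]] _]] := cells_meet cC cD.
  + by exists 1 => // p _ Cp Dp; have : (C `&` D) p by []; rewrite CD0.
  + by case: nDx; move: Cx; rewrite -CD => -[].
  have [n [phi [v [c [[_ iso] v0 lec CD]]]]] := hCD.
  have ltc : dotv v (phi x) < c.
    rewrite lt_neqAle lec// andbT; apply/eqP => e; apply: nDx.
    have : (C `&` D) x by rewrite CD.
    by case.
  have nv : 0 < enorm v.
    rewrite lt_def enorm_ge0 andbT; apply: contra_neq v0; exact: enorm_eq0.
  exists ((c - dotv v (phi x)) / enorm v); first by rewrite divr_gt0 ?subr_gt0.
  move=> p _ Cp Dp; have : (C `&` D) p by []; rewrite CD => -[_ /= <-].
  rewrite -iso// ltr_pdivlMr// -dotvBr enormB => lt.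
  have := cauchy_schwarz v (phi p - phi x).
  by rewrite leNgt (mulrC (enorm v)) (lt_le_trans lt) ?ler_norm.
- by exact: dP le (h D cD).
Qed.

Let lengths x y : set R := [set l | exists (k : nat) (p : nat -> carrier X)
                      (C : nat -> set (carrier X)),
    [/\ p 0%N = x, p k = y,
        forall i, (i < k)%N -> [/\ cells (C i), C i (p i) & C i (p i.+1)]
      & l = \sum_(i < k) cdist (C i) (p i) (p i.+1)]].

Lemma lengths_ge0 x y : lbound (lengths x y) 0.
Proof.
move=> _ [k [p [C [_ _ h ->]]]]; apply: sumr_ge0 => i _.
by have [cC Ci Ci1] := h i (ltn_ord i); exact: (cell_dist_ge0 _ _ (Xcub _ cC)).
Qed.

Lemma complex_dist_le C p q : cells C -> C p -> C q -> dist p q <= cdist C p q.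
Proof.
move=> cC Cp Cq; apply: ge_inf; first by exists 0; exact: lengths_ge0.
exists 1%N, (fun i => if i is 0%N then p else q), (fun=> C); split=> //.
  by case.
by rewrite big_ord1.
Qed.

(* The projections of the cells around x to their intersections with Q fit
   together into a 1-Lipschitz retraction onto Q of a neighborhood of x. *)
Lemma retraction_le x Q : cells Q -> Q x -> exists2 e, 0 < e &
  forall C D p q p' q', cells C -> cells D -> C x -> D x -> C p -> D q ->
  cell_proj (cdist C) (C `&` Q) x p p' -> cell_proj (cdist D) (D `&` Q) x q q' ->
  cdist C x p < e -> cdist D x q < e -> cdist Q p' q' <= dist p q.
Proof.
move=> cQ Qx; have [e0 e0_gt0 star] := star_radius x.
(* Strings of length at least [e0 / 3 + e0 / 3] are no shorter than the detour through [x]; shorter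
   ones stay within [e0] of [x], where every cell they use contains [x]. *)
exists (e0 / 3); first by rewrite divr_gt0.
move=> C D p q p' q' cC cD Cx Dx Cp Dq hp hq ltp ltq.
have dQ E r s r' s' : cells E -> E x -> E r -> E s ->
    cell_proj (cdist E) (E `&` Q) x r r' ->
    cell_proj (cdist E) (E `&` Q) x s s' -> cdist Q r' s' <= cdist E r s.
  move=> cE Ex Er Es hr hs; have [[Er' Qr'] _] := hr; have [[Es' Qs'] _] := hs.
  rewrite (cdist_meet Q E)//.
  by apply: (cell_proj_contract _ _ (Xcub _ cE)) hr hs => // ? [].
have hx E : E x -> cell_proj (cdist E) (E `&` Q) x x x by [].
have [[_ Qp'] _] := hp; have [[_ Qq'] _] := hq.
have lb : lbound (lengths p q) (cdist Q p' q'); last first.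
  rewrite /complex_dist; apply: lb_le_inf; last exact: lb.
  (* The string [p], [x], [q] shows that the infimum is over a nonempty set. *)
  exists (cdist C p x + cdist D x q), 2%N,
    (fun i => match i with 0%N => p | 1%N => x | _ => q end),
    (fun i => if i is 0%N then C else D); split=> //.
    by case=> [|[|]].
  by rewrite big_ord_recr big_ord1.
move=> _ [k [s [E [s0 sk hE ->]]]].
pose len j := \sum_(i < j) cdist (E i) (s i) (s i.+1).
have step i : (i < k)%N -> 0 <= cdist (E i) (s i) (s i.+1).
  by move=> /hE[cE Ei Ei1]; exact: (cell_dist_ge0 _ _ (Xcub _ cE)).
have len_mono j : (j <= k)%N -> len j <= len k.
  move=> jk; rewrite /len.
  rewrite -!(big_mkord xpredT (fun i => cdist (E i) (s i) (s i.+1))).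
  rewrite (big_cat_nat _ jk)//= lerDl big_nat_cond; apply: sumr_ge0 => i.
  by rewrite andbT => /andP[_ /step].
rewrite -/(len k); have [big|small] := leP (e0 / 3 + e0 / 3) (len k).
  apply: (le_trans _ big).
  apply: le_trans (cell_dist_triangle _ _ (Xcub _ cQ) _ x _ Qp' Qx Qq') _.
  apply: lerD.
    apply: le_trans (dQ C p x p' x _ _ _ _ hp (hx C Cx)) _ => //.
    by rewrite (cell_distC _ _ (Xcub _ cC))// ltW.
  by apply: le_trans (dQ D x q x q' _ _ _ _ (hx D Dx) hq) (ltW ltq).
(* Each point of the string stays in a cell of the star of [x], and its projection [r] to [Q] moves
   no faster than the string. Coherence carries [r] over to the next cell. *)
have inv j : (j <= k)%N -> exists G r, [/\ cells G, G x, G (s j),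
    cdist G x (s j) <= cdist C x p + len j /\
    cell_proj (cdist G) (G `&` Q) x (s j) r & cdist Q p' r <= len j].
  elim: j => [_|j IH jk].
    exists C, p'; rewrite s0 /len big_ord0 addr0; split=> //.
    by rewrite (cell_distxx _ _ (Xcub _ cQ)).
  have [G [r [cG Gx Gs [le hr] leQ]]] := IH (ltnW jk).
  have [cE Ej Ej1] := hE j jk.
  have lt : cdist G x (s j) < e0 by have := len_mono j (ltnW jk); lra.
  have Ex := star _ _ _ cG cE Gx Gs Ej lt.
  have hr2 := cell_proj_coherent _ _ _ _ _ _ cG cE cQ Gx Ex Qx Gs Ej hr.
  have [r' [Er' Qr' hr' _]] := meet_projection _ _ _ _ cE cQ Ex Qx Ej1.
  have [[Gr Qr] _] := hr.
  have lenS : len j.+1 = len j + cdist (E j) (s j) (s j.+1).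
    by rewrite /len big_ord_recr.
  exists (E j), r'; rewrite lenS; split=> //.
    have tri := cell_dist_triangle _ _ (Xcub _ cE) _ (s j) _ Ex Ej Ej1.
    split=> //; apply: (le_trans tri).
    by rewrite addrA lerD2r (cdist_meet (E j) G).
  apply: le_trans (cell_dist_triangle _ _ (Xcub _ cQ) _ r _ Qp' Qr Qr') _.
  by apply: lerD => //; exact: (dQ (E j)).
have [G [r [cG Gx Gs [_ hr] leQ]]] := inv k (leqnn k).
rewrite sk in Gs hr.
have hr2 := cell_proj_coherent _ _ _ _ _ _ cG cD cQ Gx Dx Qx Gs Dq hr.
by rewrite (cell_proj_uniq _ _ (Xcub _ cD) _ _ _ _ _ _ _ _ hq hr2)// => ? [].
Qed.

Lemma complex_dist_local x Q : cells Q -> Q x -> exists2 e, 0 < e &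
  forall p q, Q p -> Q q -> cdist Q x p < e -> cdist Q x q < e ->
  dist p q = cdist Q p q.
Proof.
move=> cQ Qx; have [e e0 h] := retraction_le x Q cQ Qx; exists e => // p q Qp Qq.
move=> ltp ltq; apply/eqP; rewrite eq_le complex_dist_le//=.
exact: (h Q Q).
Qed.

End CubicalComplex.

(** * Comparison triangles and geodesics in CAT(0) spaces *)

Lemma euclidean_triangle (R : realType) (p q r : R) :
  0 <= p -> 0 <= q -> 0 <= r -> p <= q + r -> q <= p + r -> r <= p + q ->
  exists u v : 'rV[R]_2, [/\ enorm u = p, enorm v = q & enorm (u - v) = r].
Proof.
move=> p0 q0 r0 pqr qpr rpq.
pose vec a b : 'rV[R]_2 := \row_(i < 2) if i == 0 then a else b.
have normE a b c : 0 <= c -> a ^+ 2 + b ^+ 2 = c ^+ 2 -> enorm (vec a b) = c.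
  move=> c0 e; rewrite /enorm /dotv !big_ord_recr big_ord0/= !mxE/= add0r.
  by rewrite -!expr2 e sqrtr_sqr ger0_norm.
have subE a b c d : vec a b - vec c d = vec (a - c) (b - d).
  by apply/rowP => i; rewrite !mxE; case: ifP.
have [p_eq0|p_neq0] := eqVneq p 0.
  exists (vec 0 0), (vec q 0); rewrite subE; split; apply: normE => //.
  - by rewrite p_eq0; ring.
  - by ring.
  - have -> : r = q by lra.
    by ring.
have pgt0 : 0 < p by rewrite lt_def p_neq0.
(* With [u] on the first axis, the law of cosines makes [m] the first coordinate of [v]. *)
pose m := (p ^+ 2 + q ^+ 2 - r ^+ 2) / (p *+ 2).
have mE : m * (p *+ 2) = p ^+ 2 + q ^+ 2 - r ^+ 2.
  by rewrite /m mulfVK// mulrn_eq0.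
have mq : m ^+ 2 <= q ^+ 2.
  have p2 : 0 < (p *+ 2) ^+ 2 by rewrite exprn_gt0// pmulrn_lgt0.
  rewrite -(ler_pM2r p2) -exprMn mE -exprMn -subr_ge0.
  (* Heron's factorization; the triangle inequalities make the factors nonnegative. *)
  have -> : (q * (p *+ 2)) ^+ 2 - (p ^+ 2 + q ^+ 2 - r ^+ 2) ^+ 2 =
    ((p + q + r) * (p + q - r)) * ((r + p - q) * (r + q - p)) by ring.
  by rewrite !mulr_ge0//; lra.
exists (vec p 0), (vec m (Num.sqrt (q ^+ 2 - m ^+ 2))); rewrite subE.
split; apply: normE => //; first by ring.
  by rewrite sqr_sqrtr ?subr_ge0//; ring.
by rewrite sub0r sqrrN sqr_sqrtr ?subr_ge0//; move: mE; lra.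
Qed.

Section CAT0.
Context {R : realType} {T : Type} (d : T -> T -> R).
Hypothesis catd : cat0 d.
Implicit Types (x y z : T) (g h : R -> T).

Let dge0 x y : 0 <= d x y. Proof. by case: catd => -[[]]. Qed.
Let dC x y : d x y = d y x. Proof. by case: catd => -[[]]. Qed.
Let dtri y x z : d x z <= d x y + d y z. Proof. by case: catd => -[[]]. Qed.
Let dxx x : d x x = 0. Proof. by case: catd => -[[_ /(_ x x)[_ ->]]]. Qed.
Let deq0 x y : d x y = 0 -> x = y.
Proof. by case: catd => -[[_ /(_ x y)[]]]. Qed.

(* Stewart-type form of the CAT(0) inequality: the right-hand side is the
   squared distance of the comparison points. *)
Lemma cat0_sqr_dist x y z g h s t : geodesic d x y g -> geodesic d x z h ->
  0 <= s <= 1 -> 0 <= t <= 1 ->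
  d (g (s * d x y)) (h (t * d x z)) ^+ 2 <=
    s ^+ 2 * d x y ^+ 2 + t ^+ 2 * d x z ^+ 2
    - s * t * (d x y ^+ 2 + d x z ^+ 2 - d y z ^+ 2).
Proof.
move=> gxy gxz s01 t01; case: (catd) => -[_ /(_ y z)[gyz hyz]].
have [u [v [un vn uvn]]] : exists u v : 'rV[R]_2,
    [/\ enorm u = d x y, enorm v = d x z & enorm (u - v) = d y z].
  apply: euclidean_triangle; rewrite ?dge0//; last by rewrite (dC x y).
  by rewrite (dC y z).
move=> /(_ x y z g gyz h 0 u v s t gxy hyz gxz) cat.
have {cat} := cat _ s01 t01; rewrite !add0r !subr0.
have tri : comparison_triangle d x y z 0 u v.
  by split; rewrite ?sub0r ?enormN.
move=> /(_ tri) le.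
have := enorm_sub (s *: u) (t *: v).
rewrite !enormZ !exprMn !real_normK ?num_real// dotvZl dotvZr un vn => e.
have := enorm_sub u v; rewrite un vn uvn => e'.
apply: (@le_trans _ _ (enorm (s *: u - t *: v) ^+ 2)).
  by rewrite ler_sqr ?nnegrE ?enorm_ge0.
by rewrite e; move: e'; nra.
Qed.

(** In the degenerate triangle [x], [y], [y] with sides [g] and [h], comparison points at equal
    times coincide. *)
Lemma geodesic_uniq x y g h t : geodesic d x y g -> geodesic d x y h ->
  0 <= t <= d x y -> g t = h t.
Proof.
move=> gg gh /andP[t0 tle].
have [dxy|dxy] := eqVneq (d x y) 0.
  have -> : t = 0 by lra.
  by case: gg gh => -> _ _ [-> _ _].
have dpos : 0 < d x y by rewrite lt_def dxy dge0.
have s01 : 0 <= t / d x y <= 1.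
  by rewrite divr_ge0 ?dge0//= ler_pdivrMr// mul1r.
have := cat0_sqr_dist _ _ _ _ _ _ _ gg gh s01 s01.
rewrite mulfVK// dxx => le; apply: deq0; apply/eqP; rewrite -sqrf_eq0.
rewrite eq_le sqr_ge0 andbT; apply: (le_trans le).
by rewrite le_eqVlt; apply/orP; left; apply/eqP; ring.
Qed.

(** Apply the CAT(0) inequality at the vertex [g r] of the triangle [g r], [g 0], [g t] to the
    points [g (r - e)] and [g t]. The overlap gives their distance as [t - r + e], which forces the
    third side up to [t]. *)
Lemma geodesic_concat g r e t : 0 < e -> e <= r -> r <= t ->
  (forall s1 s2, 0 <= s1 <= r -> 0 <= s2 <= r ->
    d (g s1) (g s2) = `|s1 - s2|) ->
  (forall s1 s2, r - e <= s1 <= t -> r - e <= s2 <= t ->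
    d (g s1) (g s2) = `|s1 - s2|) ->
  t <= d (g 0) (g t).
Proof.
move=> e0 er rt iso1 iso2.
have r0 : 0 < r by lra.
have d1 : d (g r) (g 0) = r.
  by rewrite iso1 ?subr0 ?gtr0_norm//; apply/andP; split; lra.
have d2 : d (g r) (g t) = t - r.
  by rewrite iso2 1?distrC ?ger0_norm//; try (apply/andP; split); lra.
have g1 : geodesic d (g r) (g 0) (fun s => g (r - s)).
  split; rewrite ?d1 ?subr0 ?subrr// => s1 s2 /andP[? ?] /andP[? ?].
  rewrite iso1; [|apply/andP; split; lra|apply/andP; split; lra].
  by rewrite distrC; congr `| _ |; ring.
have g2 : geodesic d (g r) (g t) (fun s => g (r + s)).
  split; rewrite ?d2 ?addr0 1?addrC ?subrK// => s1 s2 /andP[? ?] /andP[? ?].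
  rewrite iso2; [|apply/andP; split; lra|apply/andP; split; lra].
  by congr `| _ |; ring.
have s01 : 0 <= e / r <= 1.
  by rewrite (divr_ge0 (ltW e0) (ltW r0)) ler_pdivrMr// mul1r.
have one : 0 <= (1 : R) <= 1 by rewrite ler01 lexx.
have := cat0_sqr_dist _ _ _ _ _ _ _ g1 g2 s01 one.
rewrite d1 d2 mul1r mulfVK ?gt_eqF// (addrC r (t - r)) subrK iso2; last 2 first.
- by apply/andP; split; lra.
- by apply/andP; split; lra.
rewrite real_normK ?num_real// expr1n mul1r mulr1.
set D := d _ _; set f := e / r => le.
have fr : f * r = e by rewrite /f mulfVK// gt_eqF.
have f0 : 0 < f by rewrite divr_gt0.
have : f * t ^+ 2 <= f * D ^+ 2.
  by move: le; rewrite -fr; nra.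
by rewrite ler_pM2l// ler_sqr ?nnegrE ?dge0//; lra.
Qed.

(** The times in [S] form an interval from 0, on which the Lipschitz bound is tight. Around its
    supremum the curve is isometric, so [geodesic_concat] extends the interval until it reaches
    [L]. *)
Lemma local_geodesic g L : 0 <= L ->
  (forall s t, 0 <= s <= L -> 0 <= t <= L -> d (g s) (g t) <= `|s - t|) ->
  (forall r, 0 <= r <= L -> exists2 e, 0 < e & forall s t,
    0 <= s <= L -> 0 <= t <= L -> `|s - r| < e -> `|t - r| < e ->
    d (g s) (g t) = `|s - t|) ->
  d (g 0) (g L) = L.
Proof.
move=> L0 lip loc.
pose S := [set t | 0 <= t <= L /\ d (g 0) (g t) = t].
have isoS r : S r -> forall s t, 0 <= s <= r -> 0 <= t <= r ->
    d (g s) (g t) = `|s - t|.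
  move=> [/andP[r0 rL] dr].
  have key s t : 0 <= s -> s <= t -> t <= r -> d (g s) (g t) = `|s - t|.
    move=> s0 st tr.
    have lip' a b : 0 <= a -> a <= b -> b <= L -> d (g a) (g b) <= b - a.
      move=> a0 ab bL; rewrite -(ger0_norm (_ : 0 <= b - a)) ?subr_ge0//.
      by rewrite distrC lip//; apply/andP; split; lra.
    have -> : `|s - t| = t - s by rewrite distrC ger0_norm ?subr_ge0.
    have := dtri (g s) (g 0) (g r); have := dtri (g t) (g s) (g r).
    have := lip' 0 s; have := lip' s t; have := lip' t r.
    by rewrite dr; lra.
  move=> s t /andP[s0 sr] /andP[t0 tr]; have [st|/ltW ts] := leP s t.
    exact: key.
  by rewrite dC distrC key.
have downS r t : S r -> 0 <= t <= r -> S t.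
  move=> Sr /andP[t0 tr]; have [/andP[r0 rL] _] := Sr.
  split; first by apply/andP; split; lra.
  by rewrite (isoS r)// ?lexx ?r0 ?t0// sub0r normrN ger0_norm.
have S0 : S 0 by rewrite /S /= lexx L0 dxx.
have ubS : ubound S L by move=> t [/andP[_ ?]].
have supS : has_sup S by split; [exists 0|exists L].
set m := sup S.
have m0 : 0 <= m by apply: ub_le_sup => //; exists L.
have mL : m <= L by apply: ge_sup => //; exists 0.
have m0L : 0 <= m <= L by rewrite m0.
have [e e0 iso] := loc m m0L.
(* This lies beyond [m] unless [m = L]; once [S t] is shown, [t <= m] forces [t = L]. *)
pose t := Num.min L (m + e / 2).
have tL : t <= L by rewrite ge_min lexx.
have te : t <= m + e / 2 by rewrite ge_min lexx orbT.
have mt : m <= t by rewrite le_min mL/=; lra.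
have near s : 0 <= s -> m - e < s -> s <= t -> 0 <= s <= L /\ `|s - m| < e.
  move=> s0 sm st; split; first by apply/andP; split; lra.
  by rewrite ltr_norml; apply/andP; split; lra.
have St : S t.
  split; first by apply/andP; split; lra.
  have [small|big] := leP m (e / 2).
    have [||z1 z2] := near 0 (lexx 0); [lra|lra|].
    have [|||t1 t2] := near t; [lra|lra|lra|].
    by rewrite iso// sub0r normrN ger0_norm; lra.
  (* As [m] is not yet known to lie in [S], the pieces are glued at [m - e / 2]; [f <= e / 4] keeps
     [r - f] within [e] of [m]. *)
  have [r rE] : exists r, r = m - e / 2 by exists (m - e / 2).
  pose f := Num.min r (e / 4).
  have Sr : S r.
    have [|s Ss /ltW rs] := sup_adherent (eps := e / 2) _ supS; first lra.
    by apply: (downS s) => //; rewrite rE [X in _ && X]rs andbT; lra.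
  have r0 : 0 < r by lra.
  have f0 : 0 < f by rewrite lt_min r0; lra.
  have fr : f <= r by rewrite ge_min lexx.
  have fe : f <= e / 4 by rewrite ge_min lexx orbT.
  apply/eqP; rewrite eq_le; apply/andP; split.
    have t0 : 0 <= t by lra.
    by have := lip 0 t; rewrite sub0r normrN ger0_norm// lexx L0 t0 tL; apply.
  apply: (@geodesic_concat g r f t) => //; first by lra.
    exact: isoS.
  move=> s1 s2 /andP[? ?] /andP[? ?].
  have [|||? ?] := near s1; [lra|lra|lra|].
  have [|||? ?] := near s2; [lra|lra|lra|].
  exact: iso.
have tm : t <= m by apply: ub_le_sup => //; exists L.
have <- : t = L by move: tm; rewrite /t minElt; case: ifP => // _; lra.
by case: St.
Qed.

End CAT0.

(** * Angles, a passage to the limit, and segments in a cell *)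

Lemma eangleZ (R : realType) n (u v w u' w' : 'rV[R]_n) k l : 0 < k -> 0 < l ->
  u' - v = k *: (u - v) -> w' - v = l *: (w - v) -> eangle u' v w' = eangle u v w.
Proof.
move=> k0 l0 eu ew; rewrite /eangle eu ew dotvZl dotvZr !enormZ !gtr0_norm//.
congr acos; rewrite mulrA (mulrACA k) -mulf_div divff ?mul1r//.
by rewrite mulf_neq0// gt_eqF.
Qed.

(** By the law of cosines all comparison triangles give this angle, and one exists, so the default
    of [xget] is never taken. *)
Lemma comparison_angleE (R : realType) T (d : T -> T -> R) y x z :
  is_metric d -> comparison_angle d y x z =
  acos ((d y x ^+ 2 + d x z ^+ 2 - d y z ^+ 2) / 2 / (d y x * d x z)).
Proof.
move=> [dge0 _ dC dtri]; rewrite /comparison_angle; case: xgetP.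
  move=> th _ [y' [x' [z' [[e1 e2 e3] ->]]]]; rewrite /eangle -e1 -e2 -e3.
  rewrite (enormB z' x'); congr (acos (_ / _)).
  have := enorm_sub (y' - x') (z' - x').
  have -> : y' - x' - (z' - x') = y' - z' by rewrite opprB addrA subrK.
  by rewrite (enormB x' z') => ->; field.
have [u [v [un vn uv]]] : exists u v : 'rV[R]_2,
    [/\ enorm u = d y x, enorm v = d x z & enorm (u - v) = d y z].
  apply: euclidean_triangle; rewrite ?dge0//.
    by rewrite addrC (dC x z).
  by rewrite (dC y x).
move=> /(_ (eangle u 0 v)) []; exists u, 0, v; split=> //.
by split; rewrite ?subr0 ?sub0r ?enormN.
Qed.

(** Stands in for letting [s] tend to 0. The [B + 1] keeps the denominator of the contradicting [s]
    positive. *)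
Lemma small_multiples_le0 (R : realType) (M B e : R) : 0 <= B -> 0 < e ->
  (forall s, 0 < s -> s <= e -> M <= s * B) -> M <= 0.
Proof.
move=> B0 e0 h; rewrite leNgt; apply/negP => M0.
have B1 : 0 < B + 1 by lra.
pose s := Num.min e (M / (B + 1) / 2).
have s0 : 0 < s by rewrite lt_min e0 !divr_gt0.
have se : s <= e by rewrite ge_min lexx.
have : s <= M / (B + 1) / 2 by rewrite ge_min lexx orbT.
rewrite mulrAC ler_pdivlMr// mulrDr mulr1.
by have := h s s0 se; lra.
Qed.

Section CellSegment.
Context {R : realType} {T : Type} (C : set T) (dC : T -> T -> R).
Hypothesis cubeC : cube_cell C dC.

Lemma cell_dot_sqr x p q :
  dC p q ^+ 2 = dC x p ^+ 2 + dC x q ^+ 2 - cell_dot dC x p q *+ 2.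
Proof. by rewrite /cell_dot; field. Qed.

Lemma cell_dot_le x p q : C x -> C p -> C q ->
  `|cell_dot dC x p q| <= dC x p * dC x q.
Proof.
case: cubeC => n [phi [cphi _]] Cx Cp Cq; rewrite -(chart_dot _ _ cphi)//.
have [_ iso] := cphi; rewrite (cell_distC _ _ cubeC x p)//.
by rewrite (cell_distC _ _ cubeC x q)// -!iso// cauchy_schwarz.
Qed.

Lemma cell_segment {n} {phi : T -> 'rV[R]_n} : chart C dC phi ->
  forall p q, C p -> C q -> exists g : R -> T,
  [/\ g 0 = p, g (dC p q) = q,
      forall t, 0 <= t <= dC p q ->
        C (g t) /\ phi (g t) = phi p + (t / dC p q) *: (phi q - phi p)
    & forall s t, 0 <= s <= dC p q -> 0 <= t <= dC p q ->
        dC (g s) (g t) = `|s - t|].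
Proof.
move=> cphi p q Cp Cq; have [inj iso] := cphi.
have L0 := cell_dist_ge0 _ _ cubeC _ _ Cp Cq; set L := dC p q in L0 *.
have /choice[g hg] : forall t, exists r, 0 <= t <= L ->
    C r /\ phi r = phi p + (t / L) *: (phi q - phi p).
  move=> t; have [/andP[t0 tL]|nt] := boolP (0 <= t <= L); last by exists p.
  have [|r Cr e] := cell_convex _ _ cubeC cphi p q (t / L) Cp Cq.
    rewrite divr_ge0//=; have [->|L1] := eqVneq L 0.
      by rewrite invr0 mulr0 ler01.
    by rewrite ler_pdivrMr ?mul1r// lt_def L1.
  by exists r.
have pq0 : L = 0 -> phi q - phi p = 0.
  by move=> e; apply: enorm_eq0; rewrite iso// (cell_distC _ _ cubeC).
have [C0 e0] : C (g 0) /\ phi (g 0) = phi p.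
  have [|? ->] := hg 0; first by rewrite lexx.
  by rewrite mul0r scale0r addr0.
have [CL eL] : C (g L) /\ phi (g L) = phi q.
  have [|? ->] := hg L; first by rewrite L0 lexx.
  split=> //; have [/pq0 e|L1] := eqVneq L 0.
    by rewrite e scaler0 addr0; apply/eqP; rewrite eq_sym -subr_eq0 e.
  by rewrite divff// scale1r addrC subrK.
exists g; split=> //; [by apply: inj; rewrite ?inE|by apply: inj; rewrite ?inE|].
move=> s t hs ht; have [Cs es] := hg s hs; have [Ct et] := hg t ht.
rewrite -iso// es et opprD addrACA subrr add0r -scalerBl enormZ -mulrBl.
rewrite iso// (cell_distC _ _ cubeC)// -/L.
have [e|L1] := eqVneq L 0.
  rewrite e mulr0; move: hs ht; rewrite e => /andP[? ?] /andP[? ?].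
  have -> : s - t = 0 by lra.
  by rewrite normr0.
by rewrite normrM normfV (ger0_norm L0) mulfVK.
Qed.

End CellSegment.

(** * Cells in the global metric, and the lower bound on distances *)

Section CAT0CubicalComplex.
Context {R : realType} (X : polyhedral_complex R).
Hypotheses (Xfin : finite_complex X) (Xcub : cubical X).
Hypothesis Xcat0 : cat0 (@complex_dist R X).
Local Notation dist := (@complex_dist R X).
Implicit Types (P Q : set (carrier X)) (x y z w a p q : carrier X).

Lemma complex_dist_cell P p q : cells P -> P p -> P q ->
  dist p q = cdist P p q.
Proof.
move=> cP Pp Pq; have cubeP := Xcub _ cP; have [n [phi [cphi _]]] := cubeP.
have [g [g0 gL Pg iso]] := cell_segment _ _ cubeP cphi _ _ Pp Pq.
rewrite -[in LHS]g0 -[in LHS]gL; apply: (local_geodesic _ Xcat0).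
- exact: (cell_dist_ge0 _ _ cubeP).
- move=> s t hs ht; rewrite -iso//; apply: complex_dist_le => //.
    by have [] := Pg s hs.
  by have [] := Pg t ht.
move=> r hr; have [Pr _] := Pg r hr.
have [e e0 loc] := complex_dist_local _ Xfin Xcub _ _ cP Pr.
exists e => // s t hs ht ltr ltt; have [[Ps _] [Pt _]] := (Pg s hs, Pg t ht).
by rewrite loc// ?iso// distrC.
Qed.

(** The straight segment of the chart is a geodesic for [dist], and geodesics are unique. *)
Lemma cell_geodesic P n (phi : carrier X -> 'rV[R]_n) x w g :
  cells P -> chart P (cdist P) phi -> P x -> P w -> geodesic dist x w g ->
  forall t, 0 <= t <= dist x w ->
  P (g t) /\ phi (g t) = phi x + (t / dist x w) *: (phi w - phi x).
Proof.
move=> cP cphi Px Pw gg t ht; have cubeP := Xcub _ cP.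
have [h [h0 hL Ph iso]] := cell_segment _ _ cubeP cphi _ _ Px Pw.
have gh : geodesic dist x w h.
  rewrite /geodesic (complex_dist_cell P)//; split=> // s r hs hr.
  by rewrite -iso// (complex_dist_cell P)//; [case: (Ph s hs)|case: (Ph r hr)].
rewrite (geodesic_uniq _ Xcat0 _ _ _ _ _ gg gh ht).
by move: ht; rewrite (complex_dist_cell P)//; apply: Ph.
Qed.

(* Near x both sides of the angle are straight in Q, so the comparison angles
   are eventually constant. *)
Lemma alexandrov_angle_cell Q n (psi : carrier X -> 'rV[R]_n) y x z :
  cells Q -> chart Q (cdist Q) psi -> Q x -> Q y -> Q z -> y <> x -> z <> x ->
  alexandrov_angle dist y x z = eangle (psi y) (psi x) (psi z).
Proof.
move=> cQ cpsi Qx Qy Qz yx zx.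
have [[met geo] _] := Xcat0; have [dge0 deq0 dC _] := met.
have dpos u : u <> x -> 0 < dist x u.
  by move=> ux; rewrite lt_def dge0 andbT; apply/eqP => /deq0/esym.
have side u u' : Q u -> u <> x -> segment dist x u u' -> u' <> x ->
    Q u' /\ exists2 k, 0 < k & psi u' - psi x = k *: (psi u - psi x).
  move=> Qu ux [g gg [t ht ->]] tx.
  have [Qt ->] := cell_geodesic _ _ _ _ _ _ cQ cpsi Qx Qu gg t ht.
  split=> //; exists (t / dist x u); last by rewrite addrC addKr.
  rewrite divr_gt0 ?dpos// lt_def; case/andP: ht => -> _; rewrite andbT.
  by apply/eqP => t0; apply: tx; rewrite t0; case: gg.
have const (p : carrier X * carrier X) :
    segment dist x y p.1 -> p.1 <> x -> segment dist x z p.2 -> p.2 <> x ->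
    comparison_angle dist p.1 x p.2
                = eangle (psi y) (psi x) (psi z).
  move=> sy px sz qx; have [Qp [k k0 ek]] := side y p.1 Qy yx sy px.
  have [Qq [l l0 el]] := side z p.2 Qz zx sz qx.
  rewrite -(eangleZ _ _ _ _ _ _ _ _ _ k0 l0 ek el) comparison_angleE//.
  rewrite !(complex_dist_cell Q)// /eangle (chart_dot _ _ cpsi)// /cell_dot.
  have [_ iso] := cpsi.
  rewrite (cell_distC _ _ (Xcub _ cQ) x p.1)// !iso//.
  by rewrite (cell_distC _ _ (Xcub _ cQ) x p.2).
(* Points of a side arbitrarily close to [x] make the filter proper, so its limit is determined. *)
have pos u e : u <> x -> 0 < e ->
    exists v, [/\ segment dist x u v, v <> x & dist x v < e].
  move=> /dpos u0 e0; have [g gg] := geo x u; have [g0 gd giso] := gg.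
  pose t := Num.min (dist x u) (e / 2).
  have t0 : 0 < t by rewrite lt_min u0 divr_gt0.
  have tu : t <= dist x u by rewrite ge_min lexx.
  have ht : 0 <= t <= dist x u by rewrite (ltW t0).
  have dt : dist x (g t) = t.
    rewrite -{1}g0 giso ?lexx ?(ltW u0)//.
    by rewrite sub0r normrN gtr0_norm.
  exists (g t); split; first by exists g => //; exists t.
    by move=> e'; move: dt t0; rewrite e' (deq0 x x).2// => <-; rewrite ltxx.
  by rewrite dt (@le_lt_trans _ _ (e / 2)) ?ge_min ?lexx ?orbT//; lra.
have FF : ProperFilter (angle_filter dist y x z).
  apply: filter_from_proper => [|e e0].
    apply: filter_from_filter => [|i j i0 j0]; first by exists 1; rewrite /= ltr01.
    exists (Num.min i j); first by rewrite /= lt_min i0.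
    move=> p [[? ? h1] [? ? h2]]; move: h1 h2; rewrite !lt_min.
    by move=> /andP[? ?] /andP[? ?]; split; split; split.
  have [y' hy] := pos y e yx e0; have [z' hz] := pos z e zx e0.
  by exists (y', z').
apply: cvg_lim; first exact: Rhausdorff.
apply: cvg_near_cst; exists 1; first by rewrite /= ltr01.
by move=> p [[? ? _] [? ? _]]; exact: const.
Qed.

(** By Pythagoras at the projection [z'], a nearest point [z] is at distance zero from [z']. *)
Lemma nearest_point_proj P Q n (psi : carrier X -> 'rV[R]_n) x y z :
  cells P -> cells Q -> chart Q (cdist Q) psi -> P x -> Q x -> Q y ->
  nearest_point psi (P `&` Q) y z -> cell_proj (cdist Q) (Q `&` P) x y z.
Proof.
move=> cP cQ [_ iso] Px Qx Qy [[Pz Qz] hz]; have cubeQ := Xcub _ cQ.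
have [z' [Qz' Pz' hz' _]] := meet_projection _ Xcub _ _ _ _ cQ cP Qx Px Qy.
suff -> : z = z' by [].
have [_ orth] := hz'.
have := hz z' (conj Pz' Qz'); rewrite !iso// => le.
apply: (cell_dist_eq0 _ _ cubeQ) => //; apply/eqP; rewrite -sqrf_eq0.
rewrite eq_le sqr_ge0 andbT.
have : cdist Q y z ^+ 2 <= cdist Q y z' ^+ 2.
  by rewrite ler_sqr// nnegrE (cell_dist_ge0 _ _ cubeQ).
rewrite (cell_dot_sqr (cdist Q) x y z) (cell_dot_sqr (cdist Q) x y z').
rewrite (cell_dot_sqr (cdist Q) x z z') !orth// (cell_dotxx _ _ cubeQ)//.
by rewrite (cell_dotC _ _ cubeQ x z)//; lra.
Qed.

(** The point [g r] plays the role of [y], and the quotient by [r] pairs [w - x] with [(z - x) / r].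
    Near [x] distances are bounded below by the retraction and above by CAT(0). *)
Lemma dist_ge_proj P Q x w a z g r : cells P -> cells Q -> P x -> P w ->
  geodesic dist x a g -> 0 < r <= dist x a ->
  (forall t, 0 <= t <= r -> Q (g t)) ->
  cell_proj (cdist Q) (Q `&` P) x (g r) z ->
  dist x a - cell_dot (cdist P) x w z / r <= dist a w.
Proof.
move=> cP cQ Px Pw gg /andP[r0 rA] Qg hz.
have [cubeP cubeQ] := (Xcub _ cP, Xcub _ cQ).
have [[met geo] _] := Xcat0; have [dge0 deq0 dC _] := met.
have [[Qz Pz] orthz] := hz; have [g0 _ giso] := gg.
set A := dist x a; set K := cell_dot _ x w z; set W := dist x w.
have A0 : 0 < A by apply: lt_le_trans rA.
have Qx : Q x by rewrite -g0; apply: Qg; rewrite lexx ltW.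
have Qr : Q (g r) by apply: Qg; rewrite lexx ltW.
have WP : W = cdist P x w by apply: complex_dist_cell.
have gt t : 0 <= t <= r -> cdist Q x (g t) = t.
  move=> /andP[t0 tr]; rewrite -(complex_dist_cell Q)//; last first.
    by apply: Qg; rewrite t0.
  rewrite -{1}g0 giso ?lexx ?(ltW A0)//; last by rewrite t0 (le_trans tr).
  by rewrite sub0r normrN ger0_norm.
(* By [enorm_between], [g] is straight in a chart of [Q] up to time [r]. *)
have gK t q : 0 <= t <= r -> Q q ->
    cell_dot (cdist Q) x q (g t) = t / r * cell_dot (cdist Q) x q (g r).
  move=> ht Qq; have [m [psi [cpsi _]]] := cubeQ; have [_ iso] := cpsi.
  have Qt := Qg t ht.
  have e : psi (g t) - psi x = (t / r) *: (psi (g r) - psi x).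
    apply: enorm_between => //; rewrite ?iso//.
    - by rewrite (cell_distC _ _ cubeQ)// gt.
    - by rewrite (cell_distC _ _ cubeQ)// gt ?lexx ?ltW.
    rewrite opprB addrA subrK iso// -(complex_dist_cell Q)//.
    case/andP: ht => t0 tr.
    rewrite giso; [|by rewrite t0 (le_trans tr)|by rewrite rA ltW].
    by rewrite distrC ger0_norm ?subr_ge0.
  by rewrite -!(chart_dot _ _ cpsi)// e dotvZr.
have [e e0 retr] := retraction_le _ Xfin Xcub _ _ cQ Qx.
have [h hh] := geo x w.
(* Fixed from here on and small enough for the retraction to apply to [g t]; only [s] will tend to
   0. *)
pose t := Num.min r (e / 2).
have t0 : 0 < t by rewrite lt_min r0 divr_gt0.
have te : t < e by rewrite (@le_lt_trans _ _ (e / 2)) ?ge_min ?lexx ?orbT//; lra.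
have ht : 0 <= t <= r by rewrite (ltW t0) ge_min lexx.
have W0 : 0 <= W by exact: dge0.
have key s : 0 < s <= 1 -> s * W < e ->
    t / A * (W ^+ 2 + A ^+ 2 - dist a w ^+ 2) - t / r * K *+ 2 <= s * W ^+ 2.
  move=> /andP[s0 s1] sW.
  have hs : 0 <= s * W <= W by rewrite mulr_ge0 ?ler_piMl// ltW.
  have s01 : 0 <= s <= 1 by rewrite ltW.
  have t01 : 0 <= t / A <= 1.
    rewrite divr_ge0 ?(ltW t0) ?(ltW A0)//= ler_pdivrMr// mul1r.
    by case/andP: ht => _ /le_trans; apply.
  have Pws : P (h (s * W)) /\ cell_dot (cdist P) x (h (s * W)) z = s * K.
    have [n [phi [cphi _]]] := cubeP.
    have [Pws e1] := cell_geodesic _ _ _ _ _ _ cP cphi Px Pw hh _ hs.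
    split=> //; rewrite /K -!(chart_dot _ _ cphi)// e1 addrC addKr dotvZl.
    have [Weq0|Wneq0] := eqVneq W 0; last by rewrite mulfK.
    by rewrite -(deq0 x w).1// subrr dotv0l !mulr0.
  have [Pw' wK] := Pws.
  have [q [Pq Qq hq _]] := meet_projection _ Xcub _ _ _ _ cP cQ Px Qx Pw'.
  have dxw : cdist P x (h (s * W)) = s * W.
    rewrite -(complex_dist_cell P)//; have [h0 _ hiso] := hh.
    rewrite -{1}h0 hiso ?lexx ?dge0//.
    by rewrite sub0r normrN ger0_norm// mulr_ge0// ltW.
  have Qt := Qg t ht.
  have low : cdist Q q (g t) <= dist (h (s * W)) (g t).
    by apply: (retr P Q) => //; rewrite ?dxw ?gt.
  (* Both [q] and [z] lie in [P] and [Q]: pairing [q] with [g r] is pairing it with the projection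
     [z] of [g r], and this equals the pairing of [h (s * W)], which projects to [q], with [z]. *)
  have qK : cell_dot (cdist Q) x q (g t) = t / r * (s * K).
    rewrite gK// (cell_dotC _ _ cubeQ)// orthz// (cell_dotC _ _ cubeQ)//.
    by rewrite (cell_dot_meet _ Q P)// -hq.2// wK.
  have := cat0_sqr_dist _ Xcat0 _ _ _ _ _ _ _ hh gg s01 t01.
  rewrite -/W -/A mulfVK ?gt_eqF// (dC w a) => up.
  have low2 : cdist Q q (g t) ^+ 2 <= dist (h (s * W)) (g t) ^+ 2.
    by rewrite ler_sqr// ?nnegrE ?(cell_dist_ge0 _ _ cubeQ).
  have := le_trans low2 up; rewrite (cell_dot_sqr (cdist Q) x q) qK gt//.
  have := sqr_ge0 (cdist Q x q).
  have -> : (t / A) ^+ 2 * A ^+ 2 = t ^+ 2 by rewrite -exprMn mulfVK ?gt_eqF.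
  (* The square of [cdist Q x q] is dropped, the terms [t ^+ 2] cancel, and a factor [s] is divided
     out. *)
  move=> q0 le; rewrite -(ler_pM2l s0).
  by move: q0 le; set B := _ ^+ 2 + _ - _ ^+ 2; nra.
have : t / A * (W ^+ 2 + A ^+ 2 - dist a w ^+ 2) - t / r * K *+ 2 <= 0.
  have W1 : 0 < W + 1 by lra.
  apply: (@small_multiples_le0 _ _ (W ^+ 2) (Num.min 1 (e / (W + 1) / 2))).
  - exact: sqr_ge0.
  - by rewrite lt_min ltr01 !divr_gt0.
  move=> s s0; rewrite le_min => /andP[s1 sE]; apply: key; first by rewrite s0.
  by move: sE; rewrite mulrAC ler_pdivlMr// mulrDr mulr1; lra.
set D := dist a w => le.
pose c := K / r.
have le2 : W ^+ 2 + A ^+ 2 - D ^+ 2 <= A * c *+ 2.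
  rewrite -(ler_pM2l (divr_gt0 t0 A0)) -subr_le0; apply: le_trans le.
  rewrite le_eqVlt; apply/orP; left; apply/eqP; rewrite /c; field.
  by rewrite !gt_eqF.
(* Cauchy-Schwarz bounds [K] by [W] times the distance from [x] to [z], which is at most [r] since
   projecting contracts. *)
have cW : `|c| <= W.
  rewrite /c normrM normfV (gtr0_norm r0) ler_pdivrMr//.
  apply: le_trans (cell_dot_le _ _ cubeP _ _ _ Px Pw Pz) _.
  rewrite -WP ler_wpM2l// -(complex_dist_cell P)// (complex_dist_cell Q)//.
  rewrite -[leRHS](gt r) ?lexx ?(ltW r0)//.
  by apply: (cell_proj_contract _ _ cubeQ (Q `&` P) x x x (g r) z) => // ? [].
rewrite -/c; have [Ac|Ac] := leP (A - c) 0.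
  exact: le_trans Ac (dge0 _ _).
rewrite -ler_sqr ?nnegrE ?dge0 ?(ltW Ac)//.
(* This bounds [(A - c) ^+ 2] by [A ^+ 2 - A * c *+ 2 + W ^+ 2], hence by [D ^+ 2] through [le2]. *)
have : c ^+ 2 <= W ^+ 2.
  by rewrite -[c ^+ 2]real_normK ?num_real// ler_sqr ?nnegrE.
by nra.
Qed.

End CAT0CubicalComplex.

Theorem theorem4p5 (R : realType) (X : polyhedral_complex R)
    (Xfin : finite_complex X) (Xcub : cubical X)
    (Xcat0 : cat0 (@complex_dist R X))
    (n : nat) (P : set (carrier X)) (phi : carrier X -> 'rV[R]_n)
    (cellP : cells P) (chartP : chart P (cdist P) phi)
    (x a : carrier X) (Px : P x) :
  (a = x -> subdifferential phi P (complex_dist a) x 0) /\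
  (a <> x ->
   forall (y : carrier X) (Q : set (carrier X)), initial_segment x a y Q ->
   forall (m : nat) (psi : carrier X -> 'rV[R]_m), chart Q (cdist Q) psi ->
   forall z : carrier X, nearest_point psi (P `&` Q) y z ->
     (z = x -> subdifferential phi P (complex_dist a) x 0) /\
     (z <> x ->
      subdifferential phi P (complex_dist a) x
        ((cos (alexandrov_angle (@complex_dist R X) y x z)
            / enorm (phi x - phi z)) *: (phi x - phi z)))).
Proof.
have [[met _] _] := Xcat0; have [dge0 deq0 dC _] := met.
split=> [-> w Pw|ax y Q].
  by rewrite dotv0l (deq0 x x).2// subr0.
move=> [k [p [C [p0 _ p1 C0 hp]]]] m psi cpsi z near.
have [] := hp 0%N (leq0n k); rewrite p0 p1 C0.
move=> [g gg [r rA yE]] xy cellQ segQ.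
have {}xy : 0 < complex_dist x y by move: xy; rewrite (deq0 x x).2.
have [g0 _ giso] := gg.
have A0 : 0 <= complex_dist x a by [].
have dr : complex_dist x y = r.
  rewrite yE -{1}g0 giso ?lexx//.
  by rewrite sub0r normrN ger0_norm//; case/andP: rA.
have r0 : 0 < r by rewrite -dr.
have rA' : 0 < r <= complex_dist x a by rewrite r0; case/andP: rA.
have Qg t : 0 <= t <= r -> Q (g t).
  move=> ht; apply: segQ; exists g; last by exists t; rewrite ?dr.
  split=> //; first by rewrite dr.
  rewrite dr => s1 s2 /andP[? ?] /andP[? ?]; case/andP: rA => ? ?.
  by apply: giso; apply/andP; split; lra.
have Qx : Q x by rewrite -g0; apply: Qg; rewrite lexx ltW.
have Qy : Q y by rewrite yE; apply: Qg; rewrite lexx ltW.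
have hz := nearest_point_proj _ Xcub _ _ _ _ _ _ _ cellP cellQ cpsi Px Qx Qy near.
have [[Qz Pz] orthz] := hz.
have main w : P w ->
    complex_dist x a - cell_dot (cdist P) x w z / r <= complex_dist a w.
  move=> Pw; apply: (dist_ge_proj _ Xfin Xcub Xcat0 P Q) gg rA' Qg _ => //.
  by rewrite -yE.
have cubeP := Xcub _ cellP; have cubeQ := Xcub _ cellQ.
split=> [zx|zx] w Pw.
  (* The pairing with [z - x] vanishes, so [main] says that [x] minimizes the distance to [a] over
     [P]. *)
  have := main w Pw; rewrite zx -(chart_dot _ _ chartP)// subrr dotvC !dotv0l.
  by rewrite mul0r subr0 (dC a x) subr_ge0.
have yx : y <> x by move=> yx; move: xy; rewrite yx (deq0 x x).2// ltxx.
rewrite (alexandrov_angle_cell _ Xfin Xcub Xcat0 Q _ psi)// /eangle.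
have [_ isoQ] := cpsi; have [_ isoP] := chartP.
rewrite !isoQ// (chart_dot _ _ cpsi)// orthz// (cell_dotxx _ _ cubeQ)//.
rewrite isoP// (cdist_meet _ P Q)//.
rewrite (cell_distC _ _ cubeQ y)// (cell_distC _ _ cubeQ z)//.
have zr : cdist Q x z <= r.
  rewrite -dr (complex_dist_cell _ Xfin Xcub Xcat0 Q)//.
  by apply: (cell_proj_contract _ _ cubeQ (Q `&` P) x x x y z) => // ? [].
rewrite -(complex_dist_cell _ Xfin Xcub Xcat0 Q x y)// dr.
have z0 : 0 < cdist Q x z.
  rewrite lt_def (cell_dist_ge0 _ _ cubeQ)// andbT.
  by apply/eqP => /(cell_dist_eq0 _ _ cubeQ _ _ Qx Qz)/esym.
(* By orthogonality [y - x] pairs with [z - x] to the squared distance from [x] to [z], so the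
   cosine is [cdist Q x z / r], within the range of [acosK]. *)
have -> : cdist Q x z ^+ 2 / (r * cdist Q x z) = cdist Q x z / r.
  by field; rewrite !gt_eqF.
have q0 : 0 <= cdist Q x z / r by rewrite divr_ge0// ltW.
have q1 : cdist Q x z / r <= 1 by rewrite ler_pdivrMr// mul1r.
rewrite acosK; last by rewrite in_itv/= q1 andbT; lra.
(* What remains is the vector [(x - z) / r], whose pairing with [w - x] is the correction term of
   [main]. *)
have -> : cdist Q x z / r / cdist Q x z = r^-1 by field; rewrite !gt_eqF.
rewrite dotvZl -(opprB (phi z)) dotvNl (chart_dot _ _ chartP)//.
rewrite (cell_dotC _ _ cubeP)// mulrN mulrC (dC a x).
by have := main w Pw; lra.
Qed.
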